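(* For every $n\ge1$, the partial fixed-point-free involutions on $n$ letters and the $DIII$ $(n,n)$-clans in the largest sect are in bijection.
   Context: A partial permutation on $n$ letters is a map $x:\{1,\dots,n\}\to\{0,1,\dots,n\}$ such that $x(i)=x(j)\neq0$ implies $i=j$; its matrix $(x_{ij})$ has $x_{ij}=1$ if $x(i)=j$ and $x_{ij}=0$ otherwise. A partial involution is a partial permutation whose $n\times n$ matrix is symmetric; it is a partial fixed-point-free involution if moreover $x(i)\ne i$ for all $i$. An $(n,n)$-clan is a string $\gamma=c_1\cdots c_{2n}$ of symbols from $\mathbb N\cup\{+,-\}$ with equally many $+$'s and $-$'s, in which every natural number that appears appears exactly twice; two clans are equal if they have the same signs at the same positions and the same positions of matching number pairs. $rev(\gamma)=c_{2n}\cdots c_1$, and $\overline\gamma$ is obtained by exchanging $+$ and $-$. A $DIII$ $(n,n)$-clan is an $(n,n)$-clan such that (i) $\gamma=rev(\overline\gamma)$; (ii) if $c_i\in\mathbb N$ then $c_i\ne c_{2n+1-i}$; (iii) the number of $-$'s among $c_1,\dots,c_n$ plus the number of pairs $i<j\le n$ with $c_i=c_j\in\mathbb N$ is even. The base clan of $\gamma$ is obtained by replacing, for each pair $c_i=c_j\in\mathbb N$ with $i<j$, the symbol $c_i$ by $-$ and the symbol $c_j$ by $+$. A sect is the set of $DIII$ $(n,n)$-clans with a given base clan. The largest sect (corresponding to the preimage of the dense Schubert cell under $SO_{2n}/GL_n\to SO_{2n}/P$) is the one whose base clan has first $n$ symbols ${-}{-}\cdots{-}{-}$ if $n$ is even,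 and ${-}{-}\cdots{-}{+}$ ($n-1$ minus signs followed by a plus sign) if $n$ is odd, the remaining symbols being determined by skew-symmetry (i). *)

(* Defs.v *)
From HB Require Import structures.
From mathcomp Require Import all_boot all_order all_algebra.
From mathcomp Require Import zify.

Set Implicit Arguments.
Unset Strict Implicit.
Unset Printing Implicit Defensive.

Import GRing.Theory.

(* [None] plays the role of the value 0, and ['I_n] is {1, ..., n}
   shifted by one. *)
Definition pmap_on (n : nat) := {ffun 'I_n -> option 'I_n}.

Definition partial_perm n (x : pmap_on n) : bool :=
  [forall i, forall j, (x i == x j) && (x i != None) ==> (i == j)].

Definition pmap_mx n (x : pmap_on n) : 'M[int]_n :=
  (\matrix_(i, j) (x i == Some j)%:R)%R.

Definition partial_involution n (x : pmap_on n) : bool :=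
  partial_perm x && ((pmap_mx x)^T%R == pmap_mx x).

Definition partial_fpf_involution n (x : pmap_on n) : bool :=
  partial_involution x && [forall i, x i != Some i].

Inductive symbol := Num of nat | Plus | Minus.

Definition symbol_encode (c : symbol) : nat + bool :=
  match c with Num k => inl k | Plus => inr true | Minus => inr false end.
Definition symbol_decode (c : nat + bool) : symbol :=
  match c with inl k => Num k | inr true => Plus | inr false => Minus end.
Lemma symbol_encodeK : cancel symbol_encode symbol_decode.
Proof. by case. Qed.
HB.instance Definition _ := Countable.copy symbol (can_type symbol_encodeK).

Definition is_num (c : symbol) : bool := if c is Num _ then true else false.

Definition flip (c : symbol) : symbol :=
  match c with Num k => Num k | Plus => Minus | Minus => Plus end.

(* Positions are counted from 0: the first half of the string is the set of
   positions [i < n], and the position written 2n + 1 - i when counting from 1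
   is [rev_ord i]. *)
Definition word (n : nat) := (2 * n).-tuple symbol.

Definition matched n (s : word n) (i j : 'I_(2 * n)) : bool :=
  [&& i != j, is_num (tnth s i) & tnth s i == tnth s j].

Definition is_clan n (s : word n) : bool :=
  (count_mem Plus s == count_mem Minus s)
  && all (fun c => is_num c ==> (count_mem c s == 2)) s.

Definition clan_eq n (s t : word n) : bool :=
  [forall i, ((tnth s i == Plus) == (tnth t i == Plus))
             && ((tnth s i == Minus) == (tnth t i == Minus))]
  && [forall i, forall j, matched s i j == matched t i j].

(* Clans are strings up to renaming of the numbers, so the type of clans is the
   quotient of the valid strings by [clan_eq]. *)
Definition clan_word (n : nat) := {s : word n | is_clan s}.

Lemma clan_eqP n (s t : word n) :
  reflect [/\ forall i, (tnth s i == Plus) = (tnth t i == Plus),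
              forall i, (tnth s i == Minus) = (tnth t i == Minus)
            & forall i j, matched s i j = matched t i j]
          (clan_eq s t).
Proof.
apply: (iffP andP) => [[/forallP H /forallP M]|[P M H]].
  split=> [i|i|i j]; first by have /andP[/eqP] := H i.
    by have /andP[_ /eqP] := H i.
  by have /forallP/(_ j)/eqP := M i.
split; apply/forallP=> i; first by rewrite P M !eqxx.
by apply/forallP=> j; rewrite H.
Qed.

Lemma clan_eq_refl n : reflexive (@clan_eq n).
Proof. by move=> s; apply/clan_eqP. Qed.

Lemma clan_eq_sym n : symmetric (@clan_eq n).
Proof.
by move=> s t; apply/clan_eqP/clan_eqP=> -[P M H]; split=> *;
  rewrite ?P ?M ?H.
Qed.

Lemma clan_eq_trans n : transitive (@clan_eq n).
Proof.
move=> t s u /clan_eqP[P M H] /clan_eqP[P' M' H'].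
by apply/clan_eqP; split=> *; rewrite ?P ?M ?H.
Qed.

Definition clan_word_eq n : rel (clan_word n) :=
  fun s t => clan_eq (val s) (val t).

Lemma clan_word_eq_equiv n : equiv_class_of (@clan_word_eq n).
Proof.
split=> [s|s t|s t u]; rewrite /clan_word_eq.
- exact: clan_eq_refl.
- exact: clan_eq_sym.
- exact: clan_eq_trans.
Qed.

Canonical clan_word_eq_rel n := EquivRelPack (@clan_word_eq_equiv n).

Definition clan (n : nat) : choiceType := {eq_quot (clan_word_eq_rel n)}%qT.

Definition bar n (s : word n) : word n := [tuple of map flip s].
Definition reverse n (s : word n) : word n := [tuple of rev s].

Definition skew_symmetric n (s : word n) : bool :=
  clan_eq s (reverse (bar s)).

Definition no_mirror_pair n (s : word n) : bool :=
  [forall i, is_num (tnth s i) ==> (tnth s i != tnth s (rev_ord i))].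

Definition even_first_half n (s : word n) : bool :=
  ~~ odd (#|[set i : 'I_(2 * n) | (i < n) && (tnth s i == Minus)]|
          + #|[set p : 'I_(2 * n) * 'I_(2 * n) |
                [&& p.1 < p.2, p.2 < n & matched s p.1 p.2]]|).

Definition is_DIII n (s : word n) : bool :=
  [&& skew_symmetric s, no_mirror_pair s & even_first_half s].

Definition base n (s : word n) : word n :=
  [tuple (if is_num (tnth s i) then
            if [exists j : 'I_(2 * n), (i < j) && matched s i j]
            then Minus else Plus
          else tnth s i) | i < 2 * n].

Definition in_sect n (b s : word n) : bool := is_DIII s && clan_eq (base s) b.

Definition largest_base_half (n i : nat) : symbol :=
  if (i == n.-1) && odd n then Plus else Minus.

(* The second half is forced by skew-symmetry. *)
Definition largest_base (n : nat) : word n :=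
  [tuple (if i < n then largest_base_half n i
          else flip (largest_base_half n (rev_ord i))) | i < 2 * n].

Lemma is_numE c : is_num c = (c != Plus) && (c != Minus).
Proof. by case: c. Qed.

Lemma flip_eqP c : (flip c == Plus) = (c == Minus).
Proof. by case: c. Qed.

Lemma flip_eqM c : (flip c == Minus) = (c == Plus).
Proof. by case: c. Qed.

Lemma is_num_flip c : is_num (flip c) = is_num c.
Proof. by case: c. Qed.

Lemma flip_inj : injective flip.
Proof. by case=> [k||] [l||]. Qed.

Lemma tnth_reverse_bar n (s : word n) i :
  tnth (reverse (bar s)) i = flip (tnth s (rev_ord i)).
Proof.
rewrite !(tnth_nth Plus) /= nth_rev ?size_map ?size_tuple //.
by rewrite (nth_map Plus) // size_tuple; have := ltn_ord (rev_ord i).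
Qed.

Lemma matched_reverse_bar n (s : word n) i j :
  matched (reverse (bar s)) i j = matched s (rev_ord i) (rev_ord j).
Proof.
rewrite /matched !tnth_reverse_bar is_num_flip (inj_eq flip_inj).
by rewrite (inj_eq rev_ord_inj).
Qed.

Lemma clan_eq_num n (s t : word n) :
  clan_eq s t -> forall i, is_num (tnth s i) = is_num (tnth t i).
Proof. by move=> /clan_eqP[P M _] i; rewrite !is_numE P M. Qed.

Lemma reverse_bar_clan_eq n (s t : word n) :
  clan_eq s t -> clan_eq (reverse (bar s)) (reverse (bar t)).
Proof.
move=> /clan_eqP[P M H]; apply/clan_eqP; split=> [i|i|i j].
- by rewrite !tnth_reverse_bar !flip_eqP.
- by rewrite !tnth_reverse_bar !flip_eqM.
- by rewrite !matched_reverse_bar.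
Qed.

Lemma rev_ord_neq n (i : 'I_(2 * n)) : i != rev_ord i.
Proof. by apply/eqP => /(congr1 val) /=; have := ltn_ord i; lia. Qed.

Lemma is_DIII_clan_eq n (s t : word n) :
  clan_eq s t -> is_DIII s = is_DIII t.
Proof.
move=> st; have /clan_eqP[P M H] := st; rewrite /is_DIII.
congr [&& _, _ & _].
- rewrite /skew_symmetric; have rst := reverse_bar_clan_eq st.
  apply/idP/idP => h.
    by apply: clan_eq_trans (clan_eq_trans h rst); rewrite clan_eq_sym.
  by apply: clan_eq_trans st (clan_eq_trans h _); rewrite clan_eq_sym.
- apply: eq_forallb => i; have := H i (rev_ord i).
  rewrite /matched rev_ord_neq /= (clan_eq_num st).
  by case: (is_num _) => //= ->.
- rewrite /even_first_half; congr (~~ odd (_ + _)); apply: eq_card => x.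
    by rewrite !inE M.
  by rewrite !inE H.
Qed.

Lemma base_clan_eq n (s t : word n) : clan_eq s t -> base s = base t.
Proof.
move=> st; have /clan_eqP[P M H] := st; apply: eq_from_tnth => i.
rewrite !tnth_mktuple (clan_eq_num st).
under eq_existsb => j do rewrite H.
have := P i; have := M i; have := clan_eq_num st i.
by case: (tnth s i) (tnth t i) => [k||] [l||].
Qed.

Lemma in_sect_clan_eq n (b s t : word n) :
  clan_eq s t -> in_sect b s = in_sect b t.
Proof.
by move=> st; rewrite /in_sect (is_DIII_clan_eq st) (base_clan_eq st).
Qed.

(* By [DIII_clan_pi] and [DIII_sect_pi] below, the next two predicates do not
   depend on the representative. *)
Definition DIII_clan n (g : clan n) : bool := is_DIII (val (repr g)).

Definition DIII_sect n (b : word n) (g : clan n) : bool :=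
  in_sect b (val (repr g)).

Definition largest_sect n (g : clan n) : bool := DIII_sect (largest_base n) g.

Lemma repr_clan_eq n (s : clan_word n) :
  clan_eq (val (repr (\pi_(clan n) s)%qT)) (val s).
Proof. by have /eqmodP := reprK (\pi_(clan n) s)%qT. Qed.

Lemma DIII_clan_pi n (s : clan_word n) :
  DIII_clan (\pi_(clan n) s)%qT = is_DIII (val s).
Proof. exact/is_DIII_clan_eq/repr_clan_eq. Qed.

Lemma DIII_sect_pi n (b : word n) (s : clan_word n) :
  DIII_sect b (\pi_(clan n) s)%qT = in_sect b (val s).
Proof. exact/in_sect_clan_eq/repr_clan_eq. Qed.

(* Main.v *)
(* For each [i], exactly one of the two mirror positions [i] and [2n + 1 - i]
   carries a minus in the largest base clan; write [p i] for it and [q i] for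
   the other one.  In a clan of the largest sect every [p i] is a minus or the
   opening end of a pair, every [q j] is a plus or a closing end, so a pair joins
   some [p i] to some [q j].  The relation "[p i] is matched with [q j]" is the
   graph of a partial map: skew-symmetry makes it symmetric, and the absence of
   mirror pairs makes it fixed-point free.  Conversely, the clan built from such
   a map lies in the largest sect because [p i < q j] as soon as [i <> j], and
   the parity condition (iii) holds because the support of a fixed-point-free
   involution has even cardinality. *)
Require Import Defs.
From mathcomp Require Import all_boot all_order all_algebra.
From mathcomp Require Import zify.

Set Implicit Arguments.
Unset Strict Implicit.
Unset Printing Implicit Defensive.

(** * Symmetric fixed-point-free partial maps and their supports *)

Lemma partial_fpf_involutionP n (x : pmap_on n) :
  reflect ((forall i j, x i = Some j -> x j = Some i)
           /\ forall i, x i <> Some i)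
          (partial_fpf_involution x).
Proof.
apply: (iffP andP) => [[/andP[_ /eqP tx] /forallP fx]|[sx fx]].
  split=> [i j xi|i]; last exact/eqP.
  have /matrixP/(_ j i) := tx; rewrite !mxE xi eqxx.
  by case: eqP.
split; last by apply/forallP=> i; apply/eqP.
apply/andP; split.
  (* Injectivity follows from symmetry: if [x i = x j = Some k], then [x k] is both [Some i] and
     [Some j]. *)
  apply/forallP=> i; apply/forallP=> j; apply/implyP=> /andP[/eqP xij].
  case xi: (x i) => [k|//] _.
  have xk := sx _ _ xi; rewrite xij in xi.
  by have := sx _ _ xi; rewrite xk => -[->].
apply/eqP/matrixP=> i j; rewrite !mxE; congr (nat_of_bool _)%:R%R.
by apply/eqP/eqP; apply: sx.
Qed.

(** The support splits into two-cycles of [x]. The set [up] collects the smaller element of each,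
    and [x] maps it bijectively onto the set of larger ones. *)
Lemma support_even n (x : pmap_on n) :
  partial_fpf_involution x -> ~~ odd #|[set i | x i != None]|.
Proof.
move=> /partial_fpf_involutionP[sx fx].
pose up := [set i | if x i is Some j then i < j else false].
pose h (i : 'I_n) := odflt i (x i).
have h_inj : {in up &, injective h}.
  move=> i j; rewrite !inE /h.
  case xi: (x i) => [k|//] _; case xj: (x j) => [l|//] _ /= kl.
  by move: (sx _ _ xi) (sx _ _ xj); rewrite kl => -> [].
have -> : [set i | x i != None] = up :|: (h @: up).
  apply/setP=> i; rewrite !inE; case xi: (x i) => [j|] /=; last first.
    apply/esym/negbTE/imsetP=> -[j]; rewrite inE /h.
    by case xj: (x j) => [k|//] _ /= ik; have := sx _ _ xj; rewrite -ik xi.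
  case: ltnP => //= ij; apply/esym/imsetP; exists j.
    rewrite inE (sx _ _ xi) ltn_neqAle ij andbT.
    by apply/eqP=> /val_inj ji; apply: (fx i); rewrite xi ji.
  by rewrite /h (sx _ _ xi).
rewrite cardsU (card_in_imset h_inj).
suff -> : up :&: h @: up = set0 by rewrite cards0; lia.
apply/setP=> i; rewrite !inE; apply/negbTE/andP=> -[ui /imsetP[j uj ij]].
move: ui uj; rewrite inE ij /h; case xj: (x j) => [k|//] /=.
by rewrite (sx _ _ xj); lia.
Qed.

(** * Mirror positions sorted by their sign in the largest base clan *)

Section Positions.
Variable n : nat.
Implicit Types (i j : 'I_n) (k l : 'I_(2 * n)).

Lemma leq_n2n : n <= 2 * n. Proof. by lia. Qed.

(** This is [p i], and [plus_pos] is [q i]. The minus is on the left except at the last index when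
    [n] is odd. *)
Definition minus_pos i : 'I_(2 * n) :=
  if largest_base_half n i == Minus then widen_ord leq_n2n i
  else rev_ord (widen_ord leq_n2n i).

Definition plus_pos i : 'I_(2 * n) := rev_ord (minus_pos i).

Lemma pos_index_subproof k : minn k (rev_ord k) < n.
Proof. by have := ltn_ord k; rewrite /=; lia. Qed.

(** The smaller of [k] and its mirror image indexes both, which gives a common left inverse of
    [minus_pos] and [plus_pos]. *)
Definition pos_index k : 'I_n := Ordinal (pos_index_subproof k).

Lemma minus_posE i :
  minus_pos i = (if (i == n.-1 :> nat) && odd n then n else i) :> nat.
Proof.
have := ltn_ord i; rewrite /minus_pos /largest_base_half.
by case: (boolP (_ && _)) => [/andP[/eqP]|_] /= *; lia.
Qed.

Lemma plus_posE i :
  plus_pos i = (if (i == n.-1 :> nat) && odd n then n.-1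
                else 2 * n - i.+1) :> nat.
Proof. by have := ltn_ord i; rewrite /= minus_posE; case: ifP; lia. Qed.

Lemma rev_minus_pos i : rev_ord (minus_pos i) = plus_pos i.
Proof. by []. Qed.

Lemma rev_plus_pos i : rev_ord (plus_pos i) = minus_pos i.
Proof. exact: rev_ordK. Qed.

Lemma minus_posK : cancel minus_pos pos_index.
Proof.
move=> i; apply: val_inj; have := ltn_ord i.
by rewrite /= minus_posE; case: ifP; lia.
Qed.

Lemma plus_posK : cancel plus_pos pos_index.
Proof.
move=> i; apply: val_inj; have := ltn_ord i.
by rewrite /= minus_posE; case: ifP; lia.
Qed.

Lemma base_minus_pos i : tnth (largest_base n) (minus_pos i) = Minus.
Proof.
rewrite tnth_mktuple /= minus_posE /largest_base_half; have := ltn_ord i.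
case: (boolP ((_ == _) && _)) => [/andP[/eqP iE on] _|io ->].
  rewrite ltnn; suff -> : 2 * n - n.+1 = n.-1 by rewrite eqxx on.
  by lia.
by rewrite (negbTE io).
Qed.

Lemma base_plus_pos i : tnth (largest_base n) (plus_pos i) = Plus.
Proof.
rewrite tnth_mktuple rev_plus_pos plus_posE minus_posE /largest_base_half.
have := ltn_ord i; case: (boolP ((_ == _) && _)) => [/andP[/eqP iE on] _|io lti].
  by rewrite ifT ?eqxx ?on //; lia.
by rewrite ifF ?(negbTE io) //; lia.
Qed.

(** Only the last index, for odd [n], has its two positions swapped, into the middle places [n] and
    [n.-1]. When [i != j] at most one of the two indices is swapped, and the order survives; it
    fails when both are that index. *)
Lemma minus_pos_lt_plus_pos i j : i != j -> minus_pos i < plus_pos j.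
Proof.
move=> ij; have : i != j :> nat by [].
have := ltn_ord i; have := ltn_ord j; rewrite minus_posE plus_posE.
by case: ifP; case: ifP; lia.
Qed.

(** Splitting positions by base sign rather than by half treats both parities of [n] uniformly. *)
Variant position_spec : 'I_(2 * n) -> Prop :=
  | MinusPosition i : position_spec (minus_pos i)
  | PlusPosition i : position_spec (plus_pos i).

Lemma positionP k : position_spec k.
Proof.
have [->|->] : k = minus_pos (pos_index k) \/ k = plus_pos (pos_index k);
  [|left|right].
have ltk := ltn_ord k.
have [e|e] : k = pos_index k :> nat \/ k = rev_ord (widen_ord leq_n2n (pos_index k)).
- by case: (ltnP k n) => kn; [left|right; apply: val_inj]; rewrite /=; lia.
- rewrite /plus_pos /minus_pos; case: ifP => _; [left|right].
    exact/val_inj.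
  by rewrite rev_ordK; apply/val_inj.
- by rewrite /plus_pos /minus_pos; case: ifP => _; [right|left].
Qed.

Lemma minus_pos_neq_plus_pos i j : minus_pos i != plus_pos j.
Proof.
by apply/eqP=> /(congr1 (tnth (largest_base n))); rewrite base_minus_pos base_plus_pos.
Qed.

End Positions.

(** * Partners of positions in a clan *)

Lemma matched_sym n (s : word n) k l : matched s k l = matched s l k.
Proof.
rewrite /matched eq_sym [tnth s l == _]eq_sym.
by case: (tnth s k =P tnth s l) => [->|]; rewrite ?andbF.
Qed.

Lemma count_mem_tnth n (s : word n) c :
  count_mem c s = #|[set k | tnth s k == c]|.
Proof.
rewrite -[in LHS](map_tnth_enum s) count_map cardE [in RHS]/enum_mem.
by rewrite size_filter -enumT; apply: eq_count => k; rewrite /= inE.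
Qed.

(** Two distinct partners would give three positions with the same number, against its count of
    2. *)
Lemma matched_unique n (s : word n) k l m :
  is_clan s -> matched s k l -> matched s k m -> l = m.
Proof.
move=> /andP[_ /allP cs] /and3P[kl nk /eqP ekl] /and3P[km _ /eqP ekm].
have /implyP/(_ nk) := cs _ (mem_tnth k s); rewrite count_mem_tnth => /eqP c2.
apply/eqP/negPn/negP=> lm.
have : [set k; l; m] \subset [set h | tnth s h == tnth s k].
  by apply/subsetP=> h; rewrite !inE => /orP[/orP[]|] /eqP ->; rewrite -?ekl -?ekm.
move=> /subset_leq_card; rewrite c2 -setUA cardsU1 cards2 !inE negb_or kl km lm.
by [].
Qed.

Lemma matched_exists n (s : word n) k :
  is_clan s -> is_num (tnth s k) -> exists l, matched s k l.
Proof.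
move=> /andP[_ /allP cs] nk.
have /implyP/(_ nk) := cs _ (mem_tnth k s); rewrite count_mem_tnth.
rewrite (cardsD1 k) inE eqxx => /eqP[] /eqP/cards1P[l] lE.
have : l \in [set l] by rewrite inE.
rewrite -lE !inE => /andP[lk /eqP e].
by exists l; rewrite /matched eq_sym lk nk e eqxx.
Qed.

(** * From an involution to a clan of the largest sect *)

Section WordOfInvolution.
Variable n : nat.
Implicit Types (x : pmap_on n).

(* A pair is labelled by the index of its opening end. *)
Definition word_of x : word n :=
  [tuple (if tnth (largest_base n) k == Minus then
            if x (pos_index k) is Some _ then Defs.Num (pos_index k) else Minus
          else if x (pos_index k) is Some i then Defs.Num i else Plus) | k < 2 * n].

Lemma word_of_minus_pos x i :
  tnth (word_of x) (minus_pos i) = if x i is Some _ then Defs.Num i else Minus.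
Proof. by rewrite tnth_mktuple base_minus_pos minus_posK. Qed.

Lemma word_of_plus_pos x j :
  tnth (word_of x) (plus_pos j) = if x j is Some i then Defs.Num i else Plus.
Proof. by rewrite tnth_mktuple base_plus_pos plus_posK. Qed.

Lemma Num_ord_eq (i j : 'I_n) : (Defs.Num i == Defs.Num j) = (i == j).
Proof. by apply/eqP/eqP=> [[/val_inj]|->]. Qed.

Variable x : pmap_on n.
Hypothesis fpf_x : partial_fpf_involution x.
Let x_sym i j : x i = Some j -> x j = Some i.
Proof. by case/partial_fpf_involutionP: fpf_x => + _; apply. Qed.
Let x_fpf i : x i <> Some i.
Proof. by case/partial_fpf_involutionP: fpf_x => _; apply. Qed.

(** The labels are [i] on the minus side and the value of [x j] on the plus side; by symmetry of [x]
    they agree exactly when [x i = Some j]. *)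
Lemma matched_word_of_minus_plus i j :
  matched (word_of x) (minus_pos i) (plus_pos j) = (x i == Some j).
Proof.
rewrite /matched minus_pos_neq_plus_pos word_of_minus_pos word_of_plus_pos.
apply/idP/eqP => [|xi]; last by rewrite xi (x_sym xi) eqxx.
case xi: (x i) => [k|//] /=; case xj: (x j) => [l|//].
by rewrite Num_ord_eq => /eqP il; rewrite -xi; apply: x_sym; rewrite xj il.
Qed.

Lemma matched_word_of_minus_minus i j :
  matched (word_of x) (minus_pos i) (minus_pos j) = false.
Proof.
rewrite /matched !word_of_minus_pos (can_eq (@minus_posK n)).
case: eqP => //= ij; case: (x i) => [k|//]; case: (x j) => [l|//] /=.
by rewrite Num_ord_eq; apply/eqP.
Qed.

Lemma matched_word_of_plus_plus i j :
  matched (word_of x) (plus_pos i) (plus_pos j) = false.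
Proof.
rewrite /matched !word_of_plus_pos (can_eq (@plus_posK n)).
case: eqP => //= ij; case xi: (x i) => [k|//]; case xj: (x j) => [l|//] /=.
rewrite Num_ord_eq; apply/eqP=> kl; apply: ij.
by move: (x_sym xi) (x_sym xj); rewrite kl => -> [].
Qed.

Definition matched_word_ofE :=
  (matched_word_of_minus_plus, matched_word_of_minus_minus,
   matched_word_of_plus_plus).

Lemma word_of_eqP k :
  (tnth (word_of x) k == Plus) = (k \in [set plus_pos i | i in [set i | x i == None]]).
Proof.
case: (positionP k) => i.
  rewrite word_of_minus_pos; apply/esym; case: (x i) => [?|];
  by apply/negbTE/imsetP=> -[j _] /eqP; rewrite (negbTE (minus_pos_neq_plus_pos _ _)).
rewrite word_of_plus_pos mem_imset ?inE; last exact: can_inj (@plus_posK n).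
by case: (x i).
Qed.

Lemma word_of_eqM k :
  (tnth (word_of x) k == Minus) = (k \in [set minus_pos i | i in [set i | x i == None]]).
Proof.
case: (positionP k) => i.
  rewrite word_of_minus_pos mem_imset ?inE; last exact: can_inj (@minus_posK n).
  by case: (x i).
rewrite word_of_plus_pos; apply/esym; case: (x i) => [?|];
by apply/negbTE/imsetP=> -[j _] /esym/eqP; rewrite (negbTE (minus_pos_neq_plus_pos _ _)).
Qed.

Lemma count_word_of_num i j :
  x i = Some j -> count_mem (Defs.Num i) (word_of x) = 2.
Proof.
move=> xi; rewrite count_mem_tnth.
suff -> : [set k | tnth (word_of x) k == Defs.Num i] = [set minus_pos i; plus_pos j].
  by rewrite cards2 minus_pos_neq_plus_pos.
apply/setP=> k; rewrite !inE; case: (positionP k) => l.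
  rewrite word_of_minus_pos (negbTE (minus_pos_neq_plus_pos _ _)) orbF.
  rewrite (can_eq (@minus_posK n)); case xl: (x l) => [m|]; first exact: Num_ord_eq.
  by apply/esym/eqP=> li; rewrite li xi in xl.
rewrite word_of_plus_pos eq_sym.
rewrite [plus_pos l == minus_pos i]eq_sym (negbTE (minus_pos_neq_plus_pos _ _)) /=.
rewrite (can_eq (@plus_posK n)); case xl: (x l) => [m|].
  rewrite Num_ord_eq; apply/eqP/eqP => [im|lj].
    by have := x_sym xl; rewrite -im xi => -[].
  by have := x_sym xi; rewrite -lj xl => -[].
by apply/esym/eqP=> lj; rewrite lj (x_sym xi) in xl.
Qed.

(** Both signs are indexed by the set where [x] is undefined, so they are equally many. *)
Lemma word_of_is_clan : is_clan (word_of x).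
Proof.
apply/andP; split.
  rewrite !count_mem_tnth.
  have -> : [set k | tnth (word_of x) k == Plus] = [set plus_pos i | i in [set i | x i == None]].
    by apply/setP=> k; rewrite inE word_of_eqP.
  have -> : [set k | tnth (word_of x) k == Minus] = [set minus_pos i | i in [set i | x i == None]].
    by apply/setP=> k; rewrite inE word_of_eqM.
  rewrite (card_imset _ (can_inj (@plus_posK n))).
  by rewrite (card_imset _ (can_inj (@minus_posK n))).
apply/all_tnthP=> k; case: (positionP k) => i.
  rewrite word_of_minus_pos; case xi: (x i) => [j|//].
  by rewrite (count_word_of_num xi).
rewrite word_of_plus_pos; case xi: (x i) => [j|//].
by rewrite (count_word_of_num (x_sym xi)).
Qed.

(** Reversal exchanges [minus_pos i] and [plus_pos i], so it transposes the matching relation, which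
    is symmetric because [x] is. *)
Lemma word_of_skew_symmetric : skew_symmetric (word_of x).
Proof.
apply/clan_eqP; split=> [k|k|k l].
- rewrite tnth_reverse_bar flip_eqP; case: (positionP k) => i.
    by rewrite rev_minus_pos word_of_minus_pos word_of_plus_pos; case: (x i).
  by rewrite rev_plus_pos word_of_minus_pos word_of_plus_pos; case: (x i).
- rewrite tnth_reverse_bar flip_eqM; case: (positionP k) => i.
    by rewrite rev_minus_pos word_of_minus_pos word_of_plus_pos; case: (x i).
  by rewrite rev_plus_pos word_of_minus_pos word_of_plus_pos; case: (x i).
have x_eq i j : (x i == Some j) = (x j == Some i) by apply/eqP/eqP; apply: x_sym.
rewrite matched_reverse_bar; case: (positionP k) => i; case: (positionP l) => j;
rewrite ?rev_minus_pos ?rev_plus_pos ?matched_word_ofE //.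
  by rewrite matched_sym matched_word_ofE.
by rewrite matched_sym !matched_word_ofE.
Qed.

Lemma word_of_no_mirror_pair : no_mirror_pair (word_of x).
Proof.
apply/forallP=> k; apply/implyP=> nk; apply/negP=> ek.
have : matched (word_of x) k (rev_ord k) by rewrite /matched rev_ord_neq nk.
case: (positionP k) => i.
  by rewrite rev_minus_pos matched_word_ofE => /eqP/x_fpf.
by rewrite rev_plus_pos matched_sym matched_word_ofE => /eqP/x_fpf.
Qed.

(** * The parity condition *)

Lemma card_minus_pos_ge : odd #|[set i : 'I_n | n <= minus_pos i]| = odd n.
Proof.
case on: (odd n); last first.
  suff -> : [set i : 'I_n | n <= minus_pos i] = set0 by rewrite cards0.
  apply/setP=> i; rewrite !inE minus_posE on andbF; apply/negbTE.
  by rewrite -ltnNge.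
have ltn : n.-1 < n by case: (n) on.
suff -> : [set i : 'I_n | n <= minus_pos i] = [set Ordinal ltn] by rewrite cards1.
apply/setP=> i; rewrite !inE minus_posE on andbT -val_eqE /=.
by have := ltn_ord i; case: eqP; lia.
Qed.

(** The two counts are those of [N :\: E] and [E :\: N], so their sum has the parity of
    [#|N| + #|E|]. Both terms have the parity of [n]: the complement of [N] is the support of [x],
    which is even. *)
Lemma word_of_even_first_half : even_first_half (word_of x).
Proof.
rewrite /even_first_half.
pose N := [set i | x i == None].
pose E := [set i : 'I_n | n <= minus_pos i].
have -> : [set k : 'I_(2 * n) | (k < n) && (tnth (word_of x) k == Minus)]
          = [set minus_pos i | i in N :\: E].
  apply/setP=> k; rewrite inE word_of_eqM; apply/andP/imsetP=> [[kn]|[i + ->]].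
    by case/imsetP=> i iN e; exists i => //; rewrite !inE -ltnNge -e kn; rewrite inE in iN.
  rewrite !inE -ltnNge => /andP[-> iN]; split=> //.
  by apply: imset_f; rewrite inE.
rewrite (card_imset _ (can_inj (@minus_posK n))).
(* A pair inside the first half closes at some [plus_pos j] with [j] in [E]. The default of [odflt]
   is not reached outside [N]. *)
pose h (j : 'I_n) := (minus_pos (odflt j (x j)), plus_pos j).
have h_inj : injective h by move=> i j /(congr1 snd)/(can_inj (@plus_posK n)).
have -> : [set p : 'I_(2 * n) * 'I_(2 * n) |
             [&& p.1 < p.2, p.2 < n & matched (word_of x) p.1 p.2]] = h @: (E :\: N).
  apply/setP=> -[k l]; rewrite inE /=; apply/and3P/imsetP.
    case=> kl ln; move: kl; case: (positionP k) => i; last first.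
      (* A pair opening at a plus position would have to close at a minus position, against
         [minus_pos_lt_plus_pos]. *)
      case: (positionP l) ln => j ln; rewrite ?matched_word_ofE // => ij.
      rewrite matched_sym matched_word_ofE => /eqP xj.
      have : j != i by apply/eqP=> ji; apply: (@x_fpf i); rewrite -{1}ji.
      by move/minus_pos_lt_plus_pos; lia.
    case: (positionP l) ln => j ln; rewrite ?matched_word_ofE // => ij /eqP xi.
    exists j; last by rewrite /h (x_sym xi).
    by rewrite !inE (x_sym xi) /=; move: ln; rewrite /=; lia.
  case=> j; rewrite !inE /h; case xj: (x j) => [i|//] /= nj [-> ->].
  rewrite matched_word_ofE (x_sym xj) eqxx; split=> //; last by have := ltn_ord j; rewrite /=; lia.
  by apply: minus_pos_lt_plus_pos; apply/eqP=> ij; apply: (@x_fpf i); rewrite {1}ij.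
rewrite (card_imset _ h_inj).
have oE : odd #|E| = odd n := card_minus_pos_ge.
have oS : ~~ odd #|~: N|.
  have -> : ~: N = [set i | x i != None] by apply/setP=> i; rewrite !inE.
  exact: support_even.
have := cardsC N; rewrite card_ord.
have := cardsID E N; have := cardsID N E; rewrite setIC.
by move: oE oS; lia.
Qed.

(** Every pair joins a minus position to a plus position of a different index, hence opens at the
    former and closes at the latter. *)
Lemma base_word_of : base (word_of x) = largest_base n.
Proof.
apply: eq_from_tnth => k; rewrite tnth_mktuple; case: (positionP k) => i.
  rewrite base_minus_pos word_of_minus_pos; case xi: (x i) => [j|//] /=.
  rewrite ifT //; apply/existsP; exists (plus_pos j).
  rewrite matched_word_ofE xi eqxx andbT; apply: minus_pos_lt_plus_pos.
  by apply/eqP=> ij; apply: (@x_fpf i); rewrite {2}ij.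
rewrite base_plus_pos word_of_plus_pos; case xi: (x i) => [j|//] /=.
rewrite ifF //; apply/existsP=> -[l] /andP[].
case: (positionP l) => m; last by rewrite matched_word_ofE.
rewrite matched_sym matched_word_ofE => lt /eqP xm.
have : m != i by apply/eqP=> mi; apply: (@x_fpf i); rewrite -{1}mi.
by move/minus_pos_lt_plus_pos/ltn_trans/(_ lt); rewrite ltnn.
Qed.

Lemma word_of_in_sect : in_sect (largest_base n) (word_of x).
Proof.
rewrite /in_sect /is_DIII word_of_skew_symmetric word_of_no_mirror_pair.
by rewrite word_of_even_first_half base_word_of clan_eq_refl.
Qed.

End WordOfInvolution.

(** * From a clan of the largest sect to an involution *)

Definition involution_of n (s : word n) : pmap_on n :=
  [ffun i => [pick j | matched s (minus_pos i) (plus_pos j)]].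

Lemma involution_of_clan_eq n (s t : word n) :
  clan_eq s t -> involution_of s = involution_of t.
Proof.
move=> /clan_eqP[_ _ H]; apply/ffunP=> i; rewrite !ffunE.
by apply: eq_pick => j; rewrite H.
Qed.

Lemma word_ofK n (x : pmap_on n) :
  partial_fpf_involution x -> involution_of (word_of x) = x.
Proof.
move=> fx; apply/ffunP=> i; rewrite ffunE.
case: pickP => [j|nj]; first by rewrite matched_word_of_minus_plus // => /eqP.
case xi: (x i) => [j|//].
by have := nj j; rewrite matched_word_of_minus_plus // xi eqxx.
Qed.

Section InvolutionOfWord.
Variables (n : nat) (s : word n).
Hypotheses (clan_s : is_clan s) (sect_s : in_sect (largest_base n) s).

Let base_s k : tnth (base s) k = tnth (largest_base n) k.
Proof.
case/andP: sect_s => _ /clan_eqP[/(_ k) + /(_ k) + _].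
(* Equivalence becomes equality here because the largest base clan consists of signs only. *)
case: (positionP k) => i; rewrite ?base_minus_pos ?base_plus_pos eqxx.
  by move=> _ /eqP.
by move/eqP.
Qed.

Lemma sect_minus_pos i :
  tnth s (minus_pos i) = Minus \/
  exists2 k : 'I_(2 * n), minus_pos i < k & matched s (minus_pos i) k.
Proof.
have := base_s (minus_pos i); rewrite base_minus_pos tnth_mktuple.
case: ifP => [_|_]; last by left.
by case: ifP => // /existsP[k /andP[? ?]] _; right; exists k.
Qed.

Lemma sect_plus_pos j :
  tnth s (plus_pos j) = Plus \/
  is_num (tnth s (plus_pos j))
  /\ forall k : 'I_(2 * n), plus_pos j < k -> ~~ matched s (plus_pos j) k.
Proof.
have := base_s (plus_pos j); rewrite base_plus_pos tnth_mktuple.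
case: ifP => [nj|_]; last by left.
case: ifP => // /negbT; rewrite negb_exists => /forallP mj _; right; split=> // k jk.
by have := mj k; rewrite jk.
Qed.

(** The right-hand one of two matched minus positions would carry a number, hence have a second
    partner further right. *)
Lemma matched_minus_minus i j : matched s (minus_pos i) (minus_pos j) = false.
Proof.
have later (i' j' : 'I_n) : minus_pos i' < minus_pos j' ->
    ~~ matched s (minus_pos i') (minus_pos j').
  move=> lt; apply/negP=> ij.
  have [e|[k jk mk]] := sect_minus_pos j'.
    by move: ij; rewrite matched_sym /matched e andbF.
  rewrite matched_sym in ij.
  by have ek := matched_unique clan_s ij mk; rewrite -ek in jk; lia.
apply/negbTE; case: (ltngtP (minus_pos i) (minus_pos j)) => [|ji|/val_inj->].
- exact: later.
- by rewrite matched_sym; apply: later.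
- by rewrite /matched eqxx.
Qed.

(** The left-hand one of two matched plus positions would have a later partner, though it must be a
    closing end. *)
Lemma matched_plus_plus i j : matched s (plus_pos i) (plus_pos j) = false.
Proof.
have later (i' j' : 'I_n) : plus_pos i' < plus_pos j' ->
    ~~ matched s (plus_pos i') (plus_pos j').
  move=> lt; have [e|[_]] := sect_plus_pos i'; last exact.
  by rewrite /matched e andbF.
apply/negbTE; case: (ltngtP (plus_pos i) (plus_pos j)) => [|ji|/val_inj->].
- exact: later.
- by rewrite matched_sym; apply: later.
- by rewrite /matched eqxx.
Qed.

(** Partners are unique in a clan, so [pick] has at most one candidate. *)
Lemma involution_ofE i j :
  (involution_of s i == Some j) = matched s (minus_pos i) (plus_pos j).
Proof.
rewrite ffunE; case: pickP => [k mk|->] //; apply/eqP/idP => [[<-]//|mj].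
by have /(can_inj (@plus_posK n))-> := matched_unique clan_s mk mj.
Qed.

Lemma involution_of_fpf : partial_fpf_involution (involution_of s).
Proof.
case/andP: sect_s => /and3P[/clan_eqP[_ _ skew] /forallP mirror _] _.
apply/partial_fpf_involutionP; split=> [i j /eqP|i /eqP].
  rewrite involution_ofE skew matched_reverse_bar rev_minus_pos rev_plus_pos.
  by rewrite matched_sym -involution_ofE => /eqP.
rewrite involution_ofE => /and3P[_ ni e].
by have := mirror (minus_pos i); rewrite ni rev_minus_pos e.
Qed.

(** A number at a minus position has a partner, which can only be a plus position. *)
Lemma involution_of_None i :
  (involution_of s i == None) = ~~ is_num (tnth s (minus_pos i)).
Proof.
apply/eqP/idP => [xi|ni].
  apply/negP=> /(matched_exists clan_s)[k].
  case: (positionP k) => j; first by rewrite matched_minus_minus.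
  by rewrite -involution_ofE xi.
case xi: (involution_of s i) => [j|//]; move/eqP: xi.
by rewrite involution_ofE /matched (negbTE ni) andbF.
Qed.

(** Only equivalence can hold, since [word_of] chooses its own labels. *)
Lemma involution_ofK : clan_eq (word_of (involution_of s)) s.
Proof.
have fx := involution_of_fpf.
have minusE i : tnth s (minus_pos i) == Minus = (involution_of s i == None).
  rewrite involution_of_None.
  by have [->|[k _ /and3P[_ + _]]] := sect_minus_pos i; last case: (tnth s _).
have minusN i : tnth s (minus_pos i) == Plus = false.
  by have [->|[k _ /and3P[_ + _]]] := sect_minus_pos i; last case: (tnth s _).
(* Skew-symmetry carries the signs over from the minus positions. *)
have plusE i : tnth s (plus_pos i) == Plus = (involution_of s i == None).
  have := minusE i.
  case/andP: sect_s => /and3P[/clan_eqP[/(_ (plus_pos i)) + _ _] _ _] _.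
  by rewrite tnth_reverse_bar flip_eqP rev_plus_pos => ->.
have plusN i : tnth s (plus_pos i) == Minus = false.
  by have [->|[+ _]] := sect_plus_pos i; last case: (tnth s _).
apply/clan_eqP; split=> [k|k|k l].
- case: (positionP k) => i; rewrite ?word_of_minus_pos ?word_of_plus_pos.
    by rewrite minusN; case: (involution_of s i).
  by rewrite plusE; case: (involution_of s i).
- case: (positionP k) => i; rewrite ?word_of_minus_pos ?word_of_plus_pos.
    by rewrite minusE; case: (involution_of s i).
  by rewrite plusN; case: (involution_of s i).
case: (positionP k) => i; case: (positionP l) => j.
- by rewrite matched_word_of_minus_minus // matched_minus_minus.
- by rewrite matched_word_of_minus_plus // involution_ofE.
- by rewrite !(matched_sym _ (plus_pos i)) matched_word_of_minus_plus // involution_ofE.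
- by rewrite matched_word_of_plus_plus // matched_plus_plus.
Qed.

End InvolutionOfWord.

(** * The bijection on classes of words *)

Theorem theorem6p3 (n : nat) (n_ge1 : (1 <= n)%N) :
  exists f : {x : pmap_on n | partial_fpf_involution x} ->
             {g : clan n | largest_sect g},
    bijective f.
Proof.
pose w (x : {x : pmap_on n | partial_fpf_involution x}) : clan_word n :=
  Sub (word_of (val x)) (word_of_is_clan (valP x)).
have w_sect x : largest_sect (\pi_(clan n) (w x))%qT.
  by rewrite /largest_sect DIII_sect_pi word_of_in_sect // (valP x).
have inv_fpf (g : {g : clan n | largest_sect g}) :
    partial_fpf_involution (involution_of (val (repr (val g)))).
  exact: involution_of_fpf (valP (repr (val g))) (valP g).
exists (fun x => exist (@largest_sect n) _ (w_sect x)).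
exists (fun g => exist (@partial_fpf_involution n) _ (inv_fpf g)) => [x|g]; apply: val_inj.
  (* The chosen representative may differ from [w x], but [involution_of] is constant on classes. *)
  have e := involution_of_clan_eq (repr_clan_eq (w x)).
  exact: etrans e (word_ofK (valP x)).
have e : (\pi_(clan n) (w (exist (@partial_fpf_involution n) _ (inv_fpf g))) = \pi_(clan n) (repr (val g)))%qT.
  apply/eqmodP; exact: involution_ofK (valP (repr (val g))) (valP g).
exact: etrans e (reprK _).
Qed.
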